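(* Suppose the reward of each block is a constant $w>0$ and each query to the random oracle has cost $c$. Let $s=p\,q\,n$ be the expected number of solutions per round. Suppose there exists $\phi\in(0,1-s)$ such that $$c<\frac{p\,w\,\phi}{1+p\,q\,(n-1)} .$$ Then for every $\delta_1\in(0,0.25)$ such that $$c\le\frac{p\,w\,(1-\delta_1)\,\phi}{1+p\,q\,(n-1)}\qquad\text{and}\qquad 4\delta_1(1+s)+s<1-\phi,$$ Bitcoin with fixed target in a synchronous setting is an $\left(n-1,\;\dfrac{4\delta_1(1+s)+s}{1-\phi},\;0\right)$-EVP according to the utility function absolute rewards minus absolute cost, $U^j_T(\mathcal E)=R^j_T(\mathcal E)-\sum_{i:P_i\in T}C_i(\mathcal E)$.
   Context: Execution model. $\kappa$ is the security parameter. There are $n$ participants $S=\{P_1,\dots,P_n\}$, an environment $\mathcal Z$ and an adversary $\mathcal A$, all probabilistic polynomial-time (PPT) interactive machines; a control program enforces the rules below. The execution proceeds in synchronous rounds; in each round the environment activates the participants in round-robin order. There is one oracle, a random oracle modelling a hash function: each participant may ask at most $q$ queries per round, each query costs $c$, and each query independently succeeds (yields a valid block extending the chain being worked on, called a solution) with probability $p$. The parameters $n,q,p,c$ (and block rewards) are fixed, and the target (hence $p$) does not change. Messages are sent through a Diffuse functionality: the adversary sees the messages of honest participants during the round and may delay them until the end of the round, so it may deliver its own messages first (to recipients of its choice); at the end of each round every honest participant has received all messages sent by all other honest participants. An environment is $r$-admissible if it is PPT, gets input $1^{p'(\kappa)}$ for a polynomial $p'$, and runs the protocol for $r=\pi(\kappa)\neq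 0$ rounds, $\pi$ a (nonconstant) polynomial, after which it terminates the execution. Bitcoin with fixed target. Each participant keeps a local chain of blocks. An honest participant adopts the longest chain it has received, in case of a tie the one received first (so the adversary's block is always preferred in a tie); in each round it asks all its $q$ queries trying to extend its chain, even after finding a block; if it finds more than one block in a round it sends only the first one; if it receives a block in the middle of a round it does not change what it is extending until the round ends. Adversaries. A static adversary controls, from the beginning, a set $T\subseteq S$ of participants; participants outside $T$ follow the protocol (''honest''). A static adversary with fixed cost chooses at the beginning $T$ and, for each controlled participant $P_{i_m}$, the number $q-x_m$ (with $0\le x_m\le q$) of queries that participant asks in every round; otherwise its strategy is arbitrary. $H_T$ is the adversary that controls $T$ and follows the protocol (asking all $q$ queries per participant per round), except that it delivers its messages first when several solutions are produced in the same round. $\mathcal E_{\mathcal Z,\mathcal A}$ denotes the random execution with environment $\mathcal Z$ and adversary $\mathcal A$. Rewards, cost and utility. For $P_j\in S\setminus T$, $R^j_T(\mathcal E)$ is the total reward of the blocks produced by participants in $T$ that are in the local chain of $P_j$ after the last complete round $r$ of $\mathcal E$. $C_i(\mathcal E)$ is $c$ times the number of queries $P_i$ asked until the end of round $r$. Given a utility $U^j_T$ defined for each $P_j\in S\setminus T$, put $U^{\max}_T=\max_{P_j\in S\setminus T}U^j_T$ and $U^{\min}_T=\min_{P_j\in S\setminus T}U^j_T$. EVP. The protocol is a $(t,\epsilon,\epsilon')$-equilibrium with virtual payoffs (EVP) according to $\{U^j_T\}$ if for every PPT static adversary with fixed cost $\mathcal A$ controlling a set $T$ of at most $t$ participants and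 every $r$-admissible environment $\mathcal Z$, $$U^{\max}_T(\mathcal E'_{\mathcal Z,\mathcal A})\le U^{\min}_T(\mathcal E_{\mathcal Z,H_T})+\epsilon\,|U^{\min}_T(\mathcal E_{\mathcal Z,H_T})|+\epsilon'$$ with overwhelming probability in $\kappa$ (i.e. except with probability negligible in $\kappa$), where $\mathcal E_{\mathcal Z,H_T}$ and $\mathcal E'_{\mathcal Z,\mathcal A}$ are independent executions with the same environment $\mathcal Z$. *)

(* Defs.v *)
From HB Require Import structures.
From mathcomp Require Import all_boot all_order all_algebra.
From mathcomp Require Import reals.

Set Implicit Arguments.
Unset Strict Implicit.
Unset Printing Implicit Defensive.

Import Order.TTheory GRing.Theory Num.Theory.

Local Open Scope ring_scope.

Definition bits := seq bool.

Definition polynomial_values (P : {poly rat}) (f : nat -> nat) : Prop :=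
  forall kappa, (0 < kappa)%N -> (f kappa)%:R = P.[kappa%:R].

Definition polynomially_valued (f : nat -> nat) : Prop :=
  exists P : {poly rat}, polynomial_values P f.

Definition negligible (R : realType) (f : nat -> R) : Prop :=
  forall d : nat, exists K : nat, forall kappa : nat,
    (K < kappa)%N -> `|f kappa| < (kappa%:R ^+ d)^-1.

(* A reactive system: it is started on a unary input and on [pcoins kappa] fair
   coins, and then answers each incoming message. *)
Record process (I O : Type) := Process {
  pstate : Type;
  pcoins : nat -> nat;
  pinit : nat -> bits -> pstate;
  pstep : pstate -> I -> pstate * O
}.

Fixpoint answers (I O : Type) (X : process I O) (s : pstate X) (ms : seq I) :
    seq O :=
  if ms is m :: ms' then
    let: (s', o) := pstep s m in o :: answers s' ms'
  else [::].

Inductive direction := Leftwards | Stay | Rightwards.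

Record action (Q : Type) := Action {
  next_state : Q;
  written : option bool;
  work_move : direction;
  next_input : bool;
  next_coin : bool;
  emitted : option bool
}.

(* One two-way work tape over {0, 1, blank} (blank is [None]), one-way
   read-only tapes for the incoming messages and for the coins, and a one-way
   output tape.  An activation ends when an [idle] state is reached; in a
   [stopped] state the machine ignores all further messages. *)
Record itm := Itm {
  control : finType;
  initial : control;
  idle : pred control;
  stopped : pred control;
  transition : control -> option bool -> option bool -> option bool ->
    action control
}.

Record config (M : itm) := Config {
  cstate : control M;
  cleft : seq (option bool);
  chead : option bool;
  cright : seq (option bool);
  cinput : bits;
  ccoins : bits;
  coutput : bits
}.

Definition machine_step (M : itm) (k : config M) : config M :=
  let t := transition (cstate k) (ohead (cinput k)) (ohead (ccoins k))
    (chead k) in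
  let: (l, h, r) :=
    match work_move t with
    | Leftwards => (behead (cleft k), head None (cleft k),
                    written t :: cright k)
    | Stay => (cleft k, written t, cright k)
    | Rightwards => (written t :: cleft k, head None (cright k),
                     behead (cright k))
    end in
  Config (next_state t) l h r
    (if next_input t then behead (cinput k) else cinput k)
    (if next_coin t then behead (ccoins k) else ccoins k)
    (if emitted t is Some b then rcons (coutput k) b else coutput k).

Definition receive (M : itm) (k : config M) (m : bits) : config M :=
  Config (cstate k) (cleft k) (chead k) (cright k) (cinput k ++ m) (ccoins k)
    [::].

Definition activation_over (M : itm) (k : config M) : bool :=
  idle (cstate k) || stopped (cstate k).

Definition activation (M : itm) (k : config M) (m : bits) (time : nat)
    (k' : config M) : Prop :=
  k' = iter time (@machine_step M) (receive k m) /\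
  if stopped (cstate k) then time = 0%N
  else [/\ (0 < time)%N, activation_over k' &
         forall j, (0 < j < time)%N ->
           ~~ activation_over (iter j (@machine_step M) (receive k m))].

Inductive machine_run (M : itm) :
    config M -> seq bits -> seq bits -> nat -> Prop :=
| Run_nil k : machine_run k [::] [::] 0
| Run_cons k m time k' ms os time' :
    activation k m time k' -> machine_run k' ms os time' ->
    machine_run k (m :: ms) (coutput k' :: os) (time + time').

Definition enc_nat (k : nat) : bits := rcons (nseq k true) false.

Definition machine_start (M : itm) (input : nat) (coins : bits) : config M :=
  Config (initial M) [::] None [::] (enc_nat input) coins [::].

(* [X], run on the unary input [input kappa], is realised by a machine whose
   total running time, over all its activations, is polynomial in [kappa]. *)
Definition ppt (I O : Type) (encI : I -> bits) (encO : O -> bits)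
    (input : nat -> nat) (X : process I O) : Prop :=
  exists (M : itm) (time : nat -> nat), polynomially_valued time /\
    forall kappa, (0 < kappa)%N -> (time kappa <= pcoins X kappa)%N /\
      forall (coins : bits) (ms : seq I), size coins = pcoins X kappa ->
        exists2 t, (t <= time kappa)%N &
          machine_run (machine_start M (input kappa) coins)
            (map encI ms)
            (map encO (answers (pinit X (input kappa) coins) ms)) t.

Definition enc_seq (T : Type) (enc : T -> bits) (s : seq T) : bits :=
  rcons (flatten [seq true :: enc x | x <- s]) false.

Definition enc_bits : bits -> bits := enc_seq (fun b => [:: b]).

(* Producer, round, index of the successful query within the round, contents.
   The first three components identify the oracle query, so distinct
   successful queries yield distinct blocks. *)
Definition block (n : nat) : Type := ('I_n * nat * nat * bits)%type.

Definition producer (n : nat) (b : block n) : 'I_n := b.1.1.1.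

(* Last block first; the genesis block is omitted, so [::] is the initial
   chain.  A block is only ever transmitted with all its ancestors. *)
Definition chain (n : nat) : Type := seq (block n).

Definition enc_block (n : nat) (b : block n) : bits :=
  let: (i, rho, k, d) := b in
  enc_nat i ++ enc_nat rho ++ enc_nat k ++ enc_bits d.

Definition enc_chain (n : nat) : chain n -> bits := enc_seq (@enc_block n).

(* The longest of [c] and the chains of [l] (in order of reception), the
   earliest one in case of a tie. *)
Definition adopt (n : nat) (c : chain n) (l : seq (chain n)) : chain n :=
  foldl (fun c d => if (size c < size d)%N then d else c) c l.

(* Each time it is activated the environment learns the output of the
   participant it activated last, and chooses the input of the next one. *)
Record environment := Environment {
  zprocess : process bits bits;
  zinput : nat -> nat
}.

Definition admissible (r : nat -> nat) (Z : environment) : Prop :=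
  [/\ polynomially_valued (zinput Z),
      ppt enc_bits id (zinput Z) (zprocess Z),
      (exists2 P : {poly rat}, (1 < size P)%N & polynomial_values P r) &
      forall kappa, (0 < kappa)%N -> r kappa <> 0%N].

Inductive adv_in (n : nat) :=
| Setup                               (* answered by [Withhold] *)
| Input of 'I_n & bits                (* environment's input to a participant *)
| Turn of 'I_n                        (* next oracle query; answered by [Query] *)
| Answer of 'I_n & option (chain n)   (* the extended chain, if it succeeded *)
| Finish of 'I_n                      (* answered by [Output] *)
| Heard of 'I_n & chain n             (* message of an honest participant *)
| RoundEnd.                           (* answered by [Deliver] *)

Arguments Setup {n}.
Arguments Turn {n} _.
Arguments Input {n} _ _.
Arguments Finish {n} _.
Arguments RoundEnd {n}.

Inductive adv_out (n q : nat) :=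
| Silent
| Withhold of {ffun 'I_n -> 'I_q.+1}  (* the numbers x_m of queries not asked *)
| Query of chain n & bits             (* chain to extend, contents *)
| Output of bits                      (* output to the environment *)
| Deliver of seq ('I_n * chain n).    (* recipients and messages, in order *)

Arguments Silent {n q}.
Arguments Query {n q} _ _.
Arguments Output {n q} _.
Arguments Withhold {n q} _.
Arguments Deliver {n q} _.

Definition enc_in (n : nat) (m : adv_in n) : bits :=
  match m with
  | Setup => enc_nat 0
  | Input i x => enc_nat 1 ++ enc_nat i ++ enc_bits x
  | Turn i => enc_nat 2 ++ enc_nat i
  | Answer i o => enc_nat 3 ++ enc_nat i ++ enc_seq (@enc_chain n) (seq_of_opt o)
  | Finish i => enc_nat 4 ++ enc_nat i
  | Heard i c => enc_nat 5 ++ enc_nat i ++ enc_chain c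
  | RoundEnd => enc_nat 6
  end.

Definition enc_out (n q : nat) (o : adv_out n q) : bits :=
  match o with
  | Silent => [::]
  | Withhold x => enc_nat 0 ++ flatten [seq enc_nat (x i) | i <- enum 'I_n]
  | Query c d => enc_nat 1 ++ enc_chain c ++ enc_bits d
  | Output y => enc_nat 2 ++ enc_bits y
  | Deliver l =>
      enc_nat 3 ++
      enc_seq (fun m : 'I_n * chain n => enc_nat m.1 ++ enc_chain m.2) l
  end.

(* A static adversary with fixed cost: the controlled set is fixed, and the
   number of queries of each controlled participant is chosen once, in the
   answer to [Setup]. *)
Record adversary (n q : nat) := Adversary {
  corrupted : {set 'I_n};
  strategy : process (adv_in n) (adv_out n q)
}.

Definition ppt_adversary (n q : nat) (A : adversary n q) : Prop :=
  ppt (@enc_in n) (@enc_out n q) id (strategy A).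

Record global (n : nat) (SA SZ : Type) := Global {
  adv : SA;
  env : SZ;
  chains : {ffun 'I_n -> chain n};   (* local chains of honest participants *)
  seen : seq (chain n);              (* valid chains known to the adversary *)
  outbox : seq (chain n);            (* honest messages of the current round *)
  report : bits;                     (* output of the last participant *)
  asked : {ffun 'I_n -> nat}         (* queries asked so far *)
}.

Definition execution (n : nat) : Type :=
  ({ffun 'I_n -> chain n} * {ffun 'I_n -> nat})%type.

Definition local_chain (n : nat) (e : execution n) (j : 'I_n) : chain n := e.1 j.

Definition queries (n : nat) (e : execution n) (i : 'I_n) : nat := e.2 i.

(* Which oracle queries, indexed by round, participant and position, succeed *)
Definition oracle (r n q : nat) : Type := {ffun 'I_r * 'I_n * 'I_q -> bool}.

Section Execution.

Variables (n q r : nat) (A : adversary n q) (Z : environment).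
Variable omega : oracle r n q.

Local Notation T := (corrupted A).
Local Notation state := (global n (pstate (strategy A)) (pstate (zprocess Z))).

Definition count_queries (i : 'I_n) (k : nat) (f : {ffun 'I_n -> nat}) :
    {ffun 'I_n -> nat} :=
  [ffun j => if j == i then (f j + k)%N else f j].

(* All [q] queries are asked on the chain held since the beginning of the
   round, and only the first solution is sent.  The participant's own block is
   diffused like any other one: it is considered for adoption at the end of
   the round. *)
Definition honest_turn (rho : 'I_r) (i : 'I_n) (x : bits) (g : state) : state :=
  let c := chains g i in
  let asked' := count_queries i q (asked g) in
  if ohead [seq k <- enum 'I_q | omega (rho, i, k)] is Some k then
    let d : chain n := (i, rho : nat, k : nat, x) :: c in
    Global (pstep (adv g) (Heard i d)).1 (env g) (chains g) (d :: seen g)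
      (rcons (outbox g) d) (enc_chain c) asked'
  else
    Global (adv g) (env g) (chains g) (seen g) (outbox g) (enc_chain c) asked'.

(* A query on a chain that is not valid, or not known to the adversary, is
   counted but cannot succeed. *)
Definition adversarial_query (rho : 'I_r) (i : 'I_n) (g : state) (k : 'I_q) :
    state :=
  let: (a, o) := pstep (adv g) (Turn i) in
  let new : option (chain n) :=
    if o is Query c d then
      if (c \in seen g) && omega (rho, i, k)
      then Some ((i, rho : nat, k : nat, d) :: c) else None
    else None in
  Global (pstep a (Answer i new)).1 (env g) (chains g)
    (seq_of_opt new ++ seen g) (outbox g) (report g)
    (count_queries i 1 (asked g)).

Definition adversarial_turn (x : {ffun 'I_n -> 'I_q.+1}) (rho : 'I_r)
    (i : 'I_n) (input : bits) (g : state) : state :=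
  let g1 := Global (pstep (adv g) (Input i input)).1 (env g) (chains g)
    (seen g) (outbox g) (report g) (asked g) in
  let g2 := foldl (adversarial_query rho i) g1
    [seq k : 'I_q <- enum 'I_q | (k < q - x i)%N] in
  let: (a, o) := pstep (adv g2) (Finish i) in
  Global a (env g2) (chains g2) (seen g2) (outbox g2)
    (if o is Output y then y else [::]) (asked g2).

Definition turn (x : {ffun 'I_n -> 'I_q.+1}) (rho : 'I_r) (g : state)
    (i : 'I_n) : state :=
  let: (z, input) := pstep (env g) (report g) in
  let g' := Global (adv g) z (chains g) (seen g) (outbox g) (report g)
    (asked g) in
  if i \in T then adversarial_turn x rho i input g'
  else honest_turn rho i input g'.

(* Every honest participant receives the messages that the adversary addresses
   to it, then all the honest messages of the round.  As the adversary may also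
   forward honest messages, it has full control over the order of reception. *)
Definition diffuse (g : state) : state :=
  let: (a, o) := pstep (adv g) RoundEnd in
  let sent := if o is Deliver l then [seq m <- l | m.2 \in seen g] else [::] in
  Global a (env g)
    [ffun j => if j \in T then chains g j
       else adopt (chains g j) ([seq m.2 | m <- sent & m.1 == j] ++ outbox g)]
    (seen g) [::] (report g) (asked g).

Definition run_round (x : {ffun 'I_n -> 'I_q.+1}) (g : state) (rho : 'I_r) :
    state :=
  diffuse (foldl (turn x rho) g (enum 'I_n)).

Definition execute (kappa : nat) (acoins zcoins : bits) : execution n :=
  let: (a, o) := pstep (pinit (strategy A) kappa acoins) Setup in
  let x := if o is Withhold x then x else [ffun => ord_max] in
  let g0 : state :=
    Global a (pinit (zprocess Z) (zinput Z kappa) zcoins) [ffun => [::]]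
      [:: [::]] [::] [::] [ffun => 0%N] in
  let g := foldl (run_round x) g0 (enum 'I_r) in
  (chains g, asked g).

End Execution.

Record compliant_state (n : nat) := Compliant {
  hchains : {ffun 'I_n -> chain n};  (* local chains of the participants of T *)
  hinput : bits;                     (* contents of the block being mined *)
  hfound : bool;                     (* has the active participant succeeded *)
  hmined : seq (chain n);            (* messages of T in the current round *)
  hheard : seq (chain n)             (* honest messages of the current round *)
}.

Definition compliant_step (n q : nat) (s : compliant_state n) (m : adv_in n) :
    compliant_state n * adv_out n q :=
  let: Compliant cs x found mined heard := s in
  match m with
  | Setup => (s, Withhold [ffun => ord0])
  | Input _ y => (Compliant cs y false mined heard, Silent)
  | Turn i => (s, Query (cs i) x)
  | Answer _ (Some c) =>
      (Compliant cs x true (if found then mined else rcons mined c) heard,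
       Silent)
  | Answer _ None => (s, Silent)
  | Finish i => (s, Output (enc_chain (cs i)))
  | Heard _ c => (Compliant cs x found mined (rcons heard c), Silent)
  | RoundEnd =>
      (Compliant [ffun i => adopt (cs i) (mined ++ heard)] [::] false [::] [::],
       Deliver [seq (j, c) | j <- enum 'I_n, c <- mined])
  end.

Definition compliant (n q : nat) (T : {set 'I_n}) : adversary n q :=
  Adversary T (@Process (adv_in n) (adv_out n q) (compliant_state n)
    (fun=> 0%N)
    (fun _ _ => Compliant [ffun => [::]] [::] false [::] [::])
    (@compliant_step n q)).

Definition sample (r n q a z : nat) : finType :=
  (oracle r n q * a.-tuple bool * z.-tuple bool)%type.

Definition probability_of (R : realType) (p : R) (r n q a z : nat)
    (u : sample r n q a z) : R :=
  (\prod_x (if u.1.1 x then p else 1 - p)) * 2^-1 ^+ a * 2^-1 ^+ z.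

Definition samples (r : nat -> nat) (n q : nat) (A : adversary n q)
    (Z : environment) (kappa : nat) : finType :=
  sample (r kappa) n q (pcoins (strategy A) kappa) (pcoins (zprocess Z) kappa).

Definition random_execution (r : nat -> nat) (n q : nat) (A : adversary n q)
    (Z : environment) (kappa : nat) (u : samples r A Z kappa) : execution n :=
  @execute n q (r kappa) A Z u.1.1 kappa u.1.2 u.2.

Definition utility (R : realType) (n : nat) : Type :=
  {set 'I_n} -> 'I_n -> execution n -> R.

(* Maximum and minimum over the participants outside [T]; 0 when there are
   none. *)
Definition utility_max (R : realType) (n : nat) (U : utility R n)
    (T : {set 'I_n}) (e : execution n) : R :=
  if [pick j | j \notin T] is Some j0 then
    \big[Num.max/U T j0 e]_(j | j \notin T) U T j e
  else 0.

Definition utility_min (R : realType) (n : nat) (U : utility R n)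
    (T : {set 'I_n}) (e : execution n) : R :=
  if [pick j | j \notin T] is Some j0 then
    \big[Num.min/U T j0 e]_(j | j \notin T) U T j e
  else 0.

(* Bitcoin with fixed target is a (t, eps, eps')-EVP according to [U]. *)
Definition bitcoin_EVP (R : realType) (n q : nat) (p : R) (t : nat)
    (eps eps' : R) (U : utility R n) : Prop :=
  forall (A : adversary n q) (r : nat -> nat) (Z : environment),
    let T := corrupted A in
    let H := compliant q T in
    ppt_adversary A -> (#|T| <= t)%N -> admissible r Z ->
    negligible (fun kappa =>
      \sum_(u : samples r A Z kappa * samples r H Z kappa
            | ~~ (utility_max U T (random_execution u.1)
                  <= utility_min U T (random_execution u.2)
                     + eps * `|utility_min U T (random_execution u.2)| + eps'))
        probability_of p u.1 * probability_of p u.2).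

Definition reward (R : realType) (n : nat) (w : R) (T : {set 'I_n}) (j : 'I_n)
    (e : execution n) : R :=
  \sum_(b <- local_chain e j | producer b \in T) w.

Definition cost (R : realType) (n : nat) (c : R) (i : 'I_n) (e : execution n) :
    R :=
  c * (queries e i)%:R.

Definition reward_minus_cost (R : realType) (n : nat) (w c : R) : utility R n :=
  fun T j e => reward w T j e - \sum_(i in T) cost c i e.

(* Main.v *)
Require Import Defs.
From mathcomp Require Import all_boot all_order all_algebra.
From mathcomp Require Import reals sequences exp polyrcf.
From mathcomp Require Import zify ring lra.

Set Implicit Arguments.
Unset Strict Implicit.
Unset Printing Implicit Defensive.

Import Order.TTheory GRing.Theory Num.Theory.

Local Open Scope ring_scope.

(* Against an arbitrary adversary no chain contains more blocks of [T] than
   [T]'s queries had successes, a binomial number X with some m <= r q |T|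
   trials.  In a compliant execution all local chains agree after every round,
   and exactly one block of [T] is added in each round in which [T] finds a
   solution; the number Y of these rounds is binomial with r trials of
   probability P = 1 - (1 - p)^(q |T|) >= a / (1 + a), where a = p q |T|.
   Chernoff bounds give X <= p m + delta1 a r and Y >= (1 - delta1) P r except
   with probability exponentially small in r, and r grows at least linearly in
   the security parameter.  On these events the inequality between utilities
   is deterministic: since c < p w the adversary gains most with m = r q |T|,
   and the hypothesis on c keeps the compliant utility at least
   r w (1 - delta1) (1 - phi) a / (1 + a). *)

(** * Blocks of the controlled participants in a local chain *)

(** An invariant indexed by a counter. It is used at three levels: the queries of a turn, the turns
    of a round and the rounds of an execution. *)
Lemma foldl_sum (S I : Type) (inv : nat -> S -> Prop) (step : S -> I -> S)
    (f : I -> nat) (l : seq I) :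
    (forall m s a, inv m s -> inv (m + f a)%N (step s a)) ->
  forall m s, inv m s -> inv (m + \sum_(a <- l) f a)%N (foldl step s l).
Proof.
move=> stepP; elim: l => [|a l IH] m s inv_s /=; first by rewrite big_nil addn0.
by rewrite big_cons addnA; apply/IH/stepP.
Qed.

Lemma foldl_has (S I : Type) (inv : bool -> S -> Prop) (step : S -> I -> S)
    (f : pred I) (l : seq I) :
    (forall b s a, inv b s -> inv (b || f a) (step s a)) ->
  forall b s, inv b s -> inv (b || has f l) (foldl step s l).
Proof.
move=> stepP; elim: l => [|a l IH] b s inv_s /=; first by rewrite orbF.
by rewrite orbA; apply/IH/stepP.
Qed.

Lemma size_filter_ltn_ord (m q : nat) : (m <= q)%N ->
  size [seq k : 'I_q <- enum 'I_q | (k < m)%N] = m.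
Proof.
move=> le; rewrite size_filter -(count_map val (fun k => k < m)%N) val_enum_ord.
rewrite -(subnKC le) iotaD count_cat add0n.
rewrite (_ : count _ (iota 0 _) = m); last first.
  rewrite -[RHS](size_iota 0); apply/eqP; rewrite -all_count.
  by apply/allP => k; rewrite mem_iota.
rewrite (_ : count _ _ = 0%N) ?addn0 //; apply/eqP.
rewrite -leqn0 leqNgt -has_count; apply/hasPn => k; rewrite mem_iota; lia.
Qed.

Definition produced (n : nat) (T : {set 'I_n}) (d : chain n) : nat :=
  count (fun b => producer b \in T) d.

(** Same default as in [execute]: without a vector, all [q] queries are withheld. For a given
    [kappa] only the adversary's coins matter, so the value is independent of the oracle. *)
Definition withheld (n q : nat) (A : adversary n q) (kappa : nat)
    (acoins : bits) : {ffun 'I_n -> 'I_q.+1} :=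
  if (pstep (pinit (strategy A) kappa acoins) Setup).2 is Withhold x then x
  else [ffun=> ord_max].

(** Every position that [T] may use is counted, even if no valid query is made there. The index set
    is thus fixed before the oracle is sampled, and the sum is binomial given [x]. *)
Definition adversarial_solutions (r n q : nat) (T : {set 'I_n})
    (x : {ffun 'I_n -> 'I_q.+1}) (omega : oracle r n q) : nat :=
  (\sum_(rho < r) \sum_(i in T) \sum_(k < q | k < q - x i) omega (rho, i, k))%N.

Lemma adopt_mem (n : nat) (c : chain n) (l : seq (chain n)) :
  adopt c l \in c :: l.
Proof.
elim: l c => [|d l IH] c /=; first exact: mem_head.
have := IH (if (size c < size d)%N then d else c).
by rewrite !in_cons; case: ifP => _ /orP[->|->]; rewrite ?orbT.
Qed.

Section ArbitraryAdversary.

Variables (n q r : nat) (A : adversary n q) (Z : environment).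
Variables (omega : oracle r n q) (x : {ffun 'I_n -> 'I_q.+1}).

Local Notation T := (corrupted A).
Local Notation state := (global n (pstate (strategy A)) (pstate (zprocess Z))).

(* One successful query of [T] raises the maximal number of blocks of [T] in a
   known chain by at most one, so blocks need not be tracked individually. *)
Definition bounded (N : nat) (g : state) : Prop :=
  [/\ forall d, d \in seen g -> (produced T d <= N)%N,
      forall j, chains g j \in seen g & {subset outbox g <= seen g}].

Lemma adversarial_query_bounded rho i N (g : state) (k : 'I_q) : i \in T ->
  bounded N g ->
  bounded (N + omega (rho, i, k)) (adversarial_query omega rho i g k).
Proof.
move=> iT [seenP chainsP outP]; rewrite /adversarial_query.
case: (pstep (adv g) (Turn i)) => a o.
have weak (g' : state) : seen g' = seen g -> chains g' = chains g ->
    outbox g' = outbox g -> bounded (N + omega (rho, i, k)) g'.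
  move=> es ec eo; split; rewrite ?es ?ec ?eo // => d /seenP ld.
  exact: leq_trans ld (leq_addr _ _).
case: o => [|y|c d|y|l]; try exact: weak.
case: ifP => [/andP[cs om]|_]; last exact: weak.
split=> /=.
- move=> e; rewrite in_cons => /predU1P[->|/seenP].
    by rewrite /produced /= /producer /= iT om addnC leq_add2r seenP.
  by move=> le; apply: leq_trans le (leq_addr _ _).
- by move=> j; rewrite in_cons chainsP orbT.
- by move=> e /outP es; rewrite in_cons es orbT.
Qed.

(** An honest block may enter [seen], but its producer is outside [T], so the bound stays; a turn of
    [T] is a fold of queries. *)
Lemma turn_bounded rho N (g : state) (i : 'I_n) : bounded N g ->
  bounded
    (N + if i \in T then \sum_(k < q | k < q - x i) omega (rho, i, k) else 0)%N
    (turn omega x rho g i).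
Proof.
rewrite /turn; case: (pstep (env g) (report g)) => z y gN.
case: ifP => iT.
- rewrite /adversarial_turn; set g1 := (X in foldl _ X _).
  have g1N : bounded N g1 by exact: gN.
  have := foldl_sum [seq k : 'I_q <- enum 'I_q | (k < q - x i)%N]
    (fun m s a => @adversarial_query_bounded rho i m s a iT) g1N.
  rewrite big_filter big_enum_cond /=; set g2 := foldl _ _ _.
  by case: (pstep (adv g2) (Finish i)) => a o [].
rewrite addn0 /honest_turn; case: gN => seenP chainsP outP.
case: ohead => [k|] //=; split=> /=.
- move=> e; rewrite in_cons => /predU1P[->|/seenP //].
  by rewrite /produced /= /producer /= iT seenP.
- by move=> j; rewrite in_cons chainsP orbT.
- move=> e; rewrite mem_rcons !in_cons => /predU1P[->|/outP ->].
    by rewrite eqxx.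
  by rewrite orbT.
Qed.

(** The adopted chain is the old one, a delivered one (filtered by [seen]) or one from the outbox
    (contained in [seen]). *)
Lemma diffuse_bounded N (g : state) : bounded N g -> bounded N (diffuse g).
Proof.
case=> seenP chainsP outP; rewrite /diffuse.
case: (pstep (adv g) RoundEnd) => a o; split=> //= j; rewrite ffunE.
case: ifP => // _; have := adopt_mem (chains g j)
  ([seq m.2 | m <- if o is Deliver l then [seq m <- l | m.2 \in seen g]
                   else [::] & m.1 == j] ++ outbox g).
rewrite in_cons mem_cat.
case/predU1P => [->//|/orP[|/outP//]].
case/mapP => [[i d]]; rewrite mem_filter => /andP[_].
by case: o => //= l; rewrite mem_filter => /andP[ds _] ->.
Qed.

(** * Number of queries asked by the controlled participants *)

Definition asked_by (i : 'I_n) (N : nat) (g : state) : Prop := asked g i = N.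

Lemma foldl_adversarial_query_asked i rho j (l : seq 'I_q) (g : state) :
  asked (foldl (adversarial_query omega rho j) g l) i
    = (asked g i + (if i == j then size l else 0))%N.
Proof.
elim: l g => [|k l IH] g /=; first by case: ifP; rewrite addn0.
rewrite IH /adversarial_query.
by case: (pstep (adv g) (Turn j)) => a o /=; rewrite ffunE; case: eqP; lia.
Qed.

Lemma turn_asked i rho (g : state) (j : 'I_n) : i \in T ->
  asked (turn omega x rho g j) i
    = (asked g i + (if j == i then q - x i else 0))%N.
Proof.
move=> iT; rewrite /turn; case: (pstep (env g) (report g)) => z y.
case: ifP => jT.
  rewrite /adversarial_turn; set g1 := (X in foldl _ X _).
  have := foldl_adversarial_query_asked i rho j
    [seq k : 'I_q <- enum 'I_q | (k < q - x j)%N] g1.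
  set g2 := foldl _ _ _.
  case: (pstep (adv g2) (Finish j)) => a o /= ->; rewrite eq_sym.
  by case: eqP => // ->; rewrite size_filter_ltn_ord ?leq_subr.
rewrite /honest_turn; case: ohead => [k|] /=; rewrite ffunE eq_sym.
all: by case: eqP iT jT => [->|_] //; [move=> -> | rewrite addn0].
Qed.

Lemma run_round_asked i (g : state) (rho : 'I_r) : i \in T ->
  asked (run_round omega x g rho) i = (asked g i + (q - x i))%N.
Proof.
move=> iT; rewrite /run_round /diffuse; set g1 := foldl _ _ _.
case: (pstep _ _) => a o /=; rewrite {}/g1.
rewrite -[in RHS](_ :
  \sum_(j : 'I_n) (if j == i then q - x i else 0) = q - x i)%N.
  rewrite -big_enum /=.
  apply: (foldl_sum (inv := asked_by i)) => // m s j <-.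
  exact: turn_asked.
by rewrite -big_mkcond big_pred1_eq.
Qed.

Lemma run_round_bounded N (g : state) (rho : 'I_r) : bounded N g ->
  bounded (N + \sum_(i in T) \sum_(k < q | k < q - x i) omega (rho, i, k))%N
    (run_round omega x g rho).
Proof.
move=> gN; apply: diffuse_bounded; rewrite big_mkcond -big_enum /=.
apply: (foldl_sum) gN => m s i; exact: turn_bounded.
Qed.

End ArbitraryAdversary.

Lemma execute_produced (r n q kappa : nat) (A : adversary n q)
    (Z : environment) (omega : oracle r n q) (acoins zcoins : bits)
    (j : 'I_n) :
  (produced (corrupted A)
     (local_chain (execute A Z omega kappa acoins zcoins) j)
     <= adversarial_solutions (corrupted A) (withheld A kappa acoins) omega)%N.
Proof.
rewrite /execute /withheld; case: (pstep _ Setup) => a o /=.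
set x := match o with Withhold _ => _ | _ => _ end.
set g0 := Global _ _ _ _ _ _ _.
have g0P : bounded 0 g0.
  by split=> // [d | i] /=; rewrite ?ffunE mem_seq1 // => /eqP ->.
rewrite /local_chain /=.
have [seenP chainsP _] := foldl_sum (enum 'I_r)
  (fun N g rho => @run_round_bounded n q r A Z omega x N g rho) g0P.
by apply: leq_trans (seenP _ (chainsP j)) _; rewrite add0n big_enum.
Qed.

Lemma execute_queries (r n q kappa : nat) (A : adversary n q)
    (Z : environment) (omega : oracle r n q) (acoins zcoins : bits)
    (i : 'I_n) : i \in corrupted A ->
  queries (execute A Z omega kappa acoins zcoins) i
    = (r * (q - withheld A kappa acoins i))%N.
Proof.
move=> iT; rewrite /execute /withheld; case: (pstep _ Setup) => a o /=.
set x := match o with Withhold _ => _ | _ => _ end.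
set g0 := Global _ _ _ _ _ _ _.
rewrite /queries /=.
have -> : (r * (q - x i) = 0 + \sum_(rho <- enum 'I_r) (q - x i))%N.
  by rewrite add0n big_enum sum_nat_const card_ord.
apply: (foldl_sum (inv := asked_by i)).
  by move=> N g rho <-; apply: run_round_asked.
by rewrite /asked_by ffunE.
Qed.

(** * Compliant executions *)

Lemma adopt_head (n : nat) (c : chain n) (l : seq (chain n)) :
  (forall d, d \in l -> size d = (size c).+1) -> adopt c l = head c l.
Proof.
(* The first message beats [c]; the later ones only tie with it and are ignored. *)
case: l => //= d l sizeP; rewrite (sizeP d) ?mem_head // leqnn.
have : forall e, e \in l -> size e = size d.
  by move=> e el; rewrite (sizeP e) ?(sizeP d) ?mem_head // in_cons el orbT.
elim: l {sizeP} => //= e l IH sizeP.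
by rewrite (sizeP e) ?mem_head // ltnn IH // => f fl;
  rewrite sizeP // in_cons fl orbT.
Qed.

(** The messages are grouped by recipient and only the group of [i] survives the filter, so the
    order of [l], which decides ties, is preserved. *)
Lemma received_by (n : nat) (l : seq (chain n)) (i : 'I_n) :
  [seq m.2 | m <- [seq (j, c) | j <- enum 'I_n, c <- l] & m.1 == i] = l.
Proof.
have none (s : seq 'I_n) : i \notin s ->
    [seq m.2 | m <- [seq (j, c) | j <- s, c <- l] & m.1 == i] = [::].
  move=> nis; rewrite (_ : filter _ _ = [::]) //.
  apply/eqP; rewrite -[_ == _]negbK -has_filter; apply/hasPn => -[j c].
  case/allpairsP => -[j' c'] /= [j's _ [-> _]].
  by apply: contraNneq nis => <-.
have : i \in enum 'I_n by rewrite mem_enum.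
elim: (enum 'I_n) (enum_uniq 'I_n) => //= j s IH /andP[js us].
rewrite in_cons filter_cat map_cat => /predU1P[ij|si].
  rewrite -{}ij in js *; rewrite none // cats0 filter_map -map_comp.
  rewrite (eq_filter (a2 := predT)) ?filter_predT ?map_id //.
  by move=> c /=; rewrite eqxx.
rewrite IH // -[RHS]cat0s; congr cat.
rewrite filter_map -map_comp (eq_filter (a2 := pred0)) ?filter_pred0 //.
by move=> c /=; apply: contraNF js => /eqP ->.
Qed.

(** Stated on the outcomes of a single round, so that [expectation_rounds] can factor expectations
    over the rounds. *)
Definition round_solved (n q : nat) (T : {set 'I_n})
    (f : {ffun 'I_n * 'I_q -> bool}) : bool :=
  [exists i in T, exists k, f (i, k)].

Definition round_oracle (r n q : nat) (omega : oracle r n q) (rho : 'I_r) :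
    {ffun 'I_n * 'I_q -> bool} := [ffun x => omega (rho, x.1, x.2)].

Section Compliant.

Variables (n q r : nat) (T : {set 'I_n}) (Z : environment).
Variable omega : oracle r n q.

Local Notation H := (compliant q T).
Local Notation state := (global n (compliant_state n) (pstate (zprocess Z))).

(* [b] tells whether [T] has already found a solution in the current round. *)
Definition in_round (C : chain n) (b : bool) (g : state) : Prop :=
  [/\ [/\ forall i, i \notin T -> chains g i = C,
          forall i, hchains (adv g) i = C & C \in seen g],
      hheard (adv g) = outbox g,
      {subset hmined (adv g) ++ outbox g <= seen g},
      (forall d, d \in hmined (adv g) ->
         size d = (size C).+1 /\ produced T d = (produced T C).+1) /\
      (forall d, d \in outbox g ->
         size d = (size C).+1 /\ produced T d = produced T C) &
      (hmined (adv g) != [::]) = b].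

(** [hfound] concerns the active participant, whose further solutions are dropped. The implication
    ensures that the round already counts as solved when this happens. *)
Definition in_turn (C : chain n) (b : bool) (g : state) : Prop :=
  in_round C b g /\ (hfound (adv g) -> b).

Lemma compliant_query rho i C b (g : state) (k : 'I_q) : i \in T ->
  in_turn C b g ->
  in_turn C (b || omega (rho, i, k))
    (adversarial_query (A := H) omega rho i g k).
Proof.
move=> iT [[[chP hcP Cs] hhP subP [mP oP] bP] fP]; rewrite /adversarial_query.
case: g chP hcP Cs hhP subP mP oP bP fP
  => [[cs y found mined heard]] z ch se ou re ask /=.
move=> chP hcP Cs hhP subP mP oP bP fP; rewrite hcP Cs /=.
case: ifP => om /=; last by rewrite orbF; split; [split | exact: fP].
rewrite orbT; split=> //; split=> //=.
- by split=> //; rewrite in_cons Cs orbT.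
- move=> d; rewrite in_cons; case: ifP => _ /=.
    by move=> /subP ->; rewrite orbT.
  rewrite cat_rcons mem_cat in_cons orbCA -mem_cat => /predU1P[->|/subP ->].
    by rewrite eqxx.
  by rewrite orbT.
- split=> // d; case: ifP => _; first exact: mP.
  rewrite mem_rcons in_cons => /predU1P[->|/mP //].
  by rewrite /produced /= /producer /= iT.
- by case: found fP => [/(_ isT)|_]; [rewrite bP | case: (mined)].
Qed.

Lemma compliant_turn rho C b (g : state) (i : 'I_n) : in_round C b g ->
  in_round C (b || (i \in T) && [exists k, omega (rho, i, k)])
    (turn (A := H) omega [ffun=> ord0] rho g i).
Proof.
rewrite /turn; case: (pstep (env g) (report g)) => z y gP.
case: ifP => iT /=; last first.
  rewrite orbF /honest_turn /=.
  case: gP => [[chP hcP Cs] hhP subP [mP oP] bP].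
  case: g chP hcP Cs hhP subP mP oP bP
    => [[cs x found mined heard]] z' ch se ou re ask /=.
  move=> chP hcP Cs hhP subP mP oP bP; rewrite chP ?iT //.
  case: ohead => [k|] /=; last by split.
  split=> //=.
  - by split=> //; rewrite in_cons Cs orbT.
  - by rewrite hhP.
  - move=> d; rewrite mem_cat mem_rcons !in_cons orbCA -mem_cat.
    by case/predU1P => [->|/subP ->]; rewrite ?eqxx ?orbT.
  - split=> // d; rewrite mem_rcons in_cons => /predU1P[->|/oP //].
    by rewrite /produced /= /producer /= iT.
rewrite /adversarial_turn; set g1 := (X in foldl _ X _).
(* [Input] resets [hfound], so the implication holds vacuously when the turn starts. *)
have g1P : in_turn C b g1.
  case: gP => [[chP hcP Cs] hhP subP mP bP]; rewrite {}/g1.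
  case: g chP hcP Cs hhP subP mP bP
    => [[cs x found mined heard]] z' ch se ou re ask.
  by split; first by split.
have := foldl_has
    [seq k : 'I_q <- enum 'I_q | (k < q - [ffun=> ord0 : 'I_q.+1] i)%N]
    (fun b' s a => @compliant_query rho i C b' s a iT) g1P.
rewrite has_filter -filter_predI.
rewrite (eq_filter (a2 := fun k => omega (rho, i, k))); last first.
  by move=> k /=; rewrite ffunE subn0 ltn_ord andbT.
rewrite -has_filter.
have -> : has (fun k => omega (rho, i, k)) (enum 'I_q)
    = [exists k, omega (rho, i, k)].
  by apply/hasP/existsP => [[k _ ok]|[k ok]]; exists k; rewrite ?mem_enum.
set g2 := foldl _ _ _ => -[g2P _].
move: g2 g2P => [[cs x found mined heard]] z' ch se ou re ask.
by case=> [[chP hcP Cs] hhP subP mP bP].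
Qed.

Definition synchronized (m : nat) (g : state) : Prop :=
  exists C, [/\ in_round C false g, produced T C = m & outbox g = [::]].

(** All candidates are one block longer than [C], so everybody adopts the first, and those of [T]
    come before the honest ones. The common chain thus gains a block of [T] exactly when [T] solved
    the round. *)
Lemma compliant_round m (g : state) rho : synchronized m g ->
  synchronized (m + round_solved T (round_oracle omega rho))
    (run_round (A := H) omega [ffun=> ord0] g rho).
Proof.
case=> C [gP Cm _]; rewrite /run_round.
have := foldl_has (enum 'I_n)
  (fun b' s i => @compliant_turn rho C b' s i) gP.
rewrite orFb.
have -> : has (fun i => (i \in T) && [exists k, omega (rho, i, k)]) (enum 'I_n)
    = round_solved T (round_oracle omega rho).
  apply/hasP/exists_inP => [[i _ /andP[iT /existsP[k ok]]]|[i iT /existsP[k]]].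
    by exists i => //; apply/existsP; exists k; rewrite ffunE.
  rewrite ffunE => ok; exists i; rewrite ?mem_enum // iT.
  by apply/existsP; exists k.
set b := round_solved _ _; set g2 := foldl _ _ _.
move: g2 => [[cs x found mined heard]] z' ch se ou re ask.
case=> [[chP hcP Cs] hhP subP [mP oP] bP].
rewrite /= in chP hcP Cs hhP subP mP oP bP.
subst heard.
have sizeP d : d \in mined ++ ou -> size d = (size C).+1.
  by rewrite mem_cat => /orP[/mP[]|/oP[]].
exists (head C (mined ++ ou)); rewrite /diffuse /=; split=> //; last first.
  rewrite -Cm; case: (mined) bP mP => [|d l] <- mP' /=; last first.
    by rewrite addn1; case: (mP' d (mem_head _ _)).
  by rewrite addn0; case: (ou) oP => //= d l oP'; case: (oP' d (mem_head _ _)).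
split=> //=; split=> [i iT|i|].
- rewrite ffunE (negbTE iT) chP //.
  rewrite -(adopt_head sizeP); congr (adopt C (_ ++ _)).
  have -> : [seq m0 <- [seq (j, c) | j <- enum 'I_n, c <- mined] | m0.2 \in se]
     = [seq (j, c) | j <- enum 'I_n, c <- mined].
    apply/all_filterP/allP => -[j c] /allpairsP[[j' c'] /= [_ c'm [_ ->]]].
    by apply: subP; rewrite mem_cat c'm.
  exact: received_by.
- by rewrite ffunE hcP adopt_head.
- by case: (mined ++ ou) subP => [|d l subP] //=; apply: subP; rewrite mem_head.
Qed.

Lemma execute_compliant (kappa : nat) (acoins zcoins : bits) (j : 'I_n) :
  j \notin T ->
  produced T (local_chain (execute H Z omega kappa acoins zcoins) j)
    = (\sum_(rho < r) round_solved T (round_oracle omega rho))%N.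
Proof.
move=> jT; rewrite /execute /local_chain /=.
set g0 := Global _ _ _ _ _ _ _.
have g0P : synchronized 0 g0.
  by exists [::]; split=> //; split=> //; split=> // i; rewrite ffunE.
have [C [[[chP _ _] _ _ _ _] Cm _]] := foldl_sum (enum 'I_r)
  (fun m s rho => @compliant_round m s rho) g0P.
by rewrite chP // Cm /= add0n big_enum.
Qed.

End Compliant.

(** * Chernoff bounds for the oracle *)

Section Chernoff.

Variables (R : realType) (p : R).
Hypothesis hp : 0 <= p <= 1.

Let p_ge0 : 0 <= p. Proof. by case/andP: hp. Qed.
Let q_ge0 : 0 <= 1 - p. Proof. by rewrite subr_ge0; case/andP: hp. Qed.

Definition bernoulli_weight (I : finType) (f : {ffun I -> bool}) : R :=
  \prod_x (if f x then p else 1 - p).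

Lemma bernoulli_weight_ge0 (I : finType) (f : {ffun I -> bool}) :
  0 <= bernoulli_weight f.
Proof. by apply: prodr_ge0 => x _; case: ifP. Qed.

(** Independence of the positions, in the form of distributivity of products over sums. *)
Lemma expectation_prod (I : finType) (h : I -> bool -> R) :
  \sum_f bernoulli_weight f * \prod_x h x (f x)
    = \prod_x (p * h x true + (1 - p) * h x false).
Proof.
transitivity (\prod_x \sum_b (if b then p else 1 - p) * h x b).
  by rewrite bigA_distr_bigA; apply: eq_bigr => f _; rewrite -big_split.
by apply: eq_bigr => x _; rewrite big_bool.
Qed.

(** Independence of the rounds: currying identifies an oracle with a family of round outcomes, and
    its weight is the product of theirs. *)
Lemma expectation_rounds (r n q : nat)
    (g : 'I_r -> {ffun 'I_n * 'I_q -> bool} -> R) :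
  \sum_(omega : oracle r n q)
      bernoulli_weight omega * \prod_rho g rho (round_oracle omega rho)
    = \prod_rho \sum_f bernoulli_weight f * g rho f.
Proof.
rewrite bigA_distr_bigA.
pose curry (omega : oracle r n q) := [ffun rho => round_oracle omega rho].
pose uncurry (F : {ffun 'I_r -> {ffun 'I_n * 'I_q -> bool}}) : oracle r n q :=
  [ffun x => F x.1.1 (x.1.2, x.2)].
rewrite (reindex curry) /=; last first.
  exists uncurry => [omega _|F _].
    by apply/ffunP => -[[rho i] k]; rewrite !ffunE.
  by apply/ffunP => rho; apply/ffunP => -[i k]; rewrite !ffunE.
apply: eq_bigr => omega _; rewrite big_split /=; congr (_ * _); last first.
  by apply: eq_bigr => rho _; rewrite ffunE.
rewrite pair_big /=; unfold bernoulli_weight.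
rewrite [LHS](reindex (fun x : 'I_r * ('I_n * 'I_q) =>
  (x.1, x.2.1, x.2.2))) /=; last first.
  by exists (fun x => (x.1.1, (x.1.2, x.2))) => [[? []]|[[? ?] ?]].
by apply: eq_bigr => -[rho [i k]] _; rewrite !ffunE.
Qed.

Lemma expectation1 (I : finType) :
  \sum_(f : {ffun I -> bool}) bernoulli_weight f = 1.
Proof.
transitivity (\sum_(f : {ffun I -> bool}) bernoulli_weight f * \prod_(x : I) 1).
  by apply: eq_bigr => f _; rewrite big1 ?mulr1.
by rewrite (expectation_prod (fun _ _ => 1)) big1 // => x _; ring.
Qed.

(** Obtained by inverting [1 - l <= expR (- l)]. The rational bound makes the sign of the Chernoff
    exponent an algebraic question. *)
Lemma expR_sub1_le (l : R) : 0 <= l < 1 -> expR l - 1 <= l / (1 - l).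
Proof.
case/andP=> l_ge0 l_lt1; have l1 : 0 < 1 - l by lra.
rewrite (_ : l / (1 - l) = (1 - l)^-1 - 1); last by field; lra.
rewrite lerD2r -[expR l]invrK -expRN lef_pV2 ?posrE ?expR_gt0 //.
exact: expR_ge1Dx.
Qed.

(** Each position of [S] contributes a factor at most [expR (p * (l / (1 - l)))]. The deviation is a
    multiple of [M] and not of the mean, which makes the bound uniform in the number of withheld
    queries. *)
Lemma chernoff_upper (I : finType) (S : {set I}) (l d M : R) : 0 <= l < 1 ->
  p * #|S|%:R <= M ->
  \sum_f bernoulli_weight f
      * expR (l * (\sum_(x in S) (f x)%:R - p * #|S|%:R - d * M))
    <= expR (l * M * (l / (1 - l) - d)).
Proof.
move=> hl hM; have /andP[l_ge0 l_lt1] := hl.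
pose h (x : I) (b : bool) : R := if x \in S then expR (l * b%:R) else 1.
have -> : \sum_(f : {ffun I -> bool}) bernoulli_weight f
      * expR (l * (\sum_(x in S) (f x)%:R - p * #|S|%:R - d * M))
    = (\sum_f bernoulli_weight f * \prod_x h x (f x))
      * expR (- (l * (p * #|S|%:R + d * M))).
  rewrite mulr_suml; apply: eq_bigr => f _; rewrite -mulrA; congr (_ * _).
  rewrite /h -big_mkcond /= -expR_sum -expRD; congr expR.
  by rewrite -mulr_sumr; ring.
rewrite expectation_prod.
have bound : \prod_x (p * h x true + (1 - p) * h x false)
    <= expR (\sum_(x in S) p * (l / (1 - l))).
  rewrite [in leRHS]big_mkcond expR_sum; apply: ler_prod => x _; rewrite /h.
  case: (x \in S); last by rewrite expR0 !mulr1; apply/andP; split; lra.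
  rewrite mulr1 mulr0 expR0 mulr1; apply/andP; split.
    by rewrite addr_ge0 ?mulr_ge0 ?expR_ge0 //; lra.
  apply: le_trans (expR_ge1Dx _); have := expR_sub1_le hl.
  have -> : p * expR l + (1 - p) = 1 + p * (expR l - 1) by ring.
  by move=> le; rewrite lerD2l ler_wpM2l //; lra.
apply: le_trans (ler_wpM2r (expR_ge0 _) bound) _.
rewrite -expRD ler_expR sumr_const -[_ *+ _]mulr_natr.
have l1 : 0 < 1 - l by lra.
have -> : p * (l / (1 - l)) * #|S|%:R - l * (p * #|S|%:R + d * M)
    = l * (p * #|S|%:R * (l / (1 - l)) - d * M) by field; lra.
rewrite -[leRHS]mulrA ler_wpM2l // mulrBr [d * M]mulrC lerD2r ler_wpM2r //.
by rewrite divr_ge0 // ltW.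
Qed.

(** Failure of [T] in a round is a conjunction over its [q * #|T|] positions, so its indicator is
    the product of the factors [h]. *)
Lemma expectation_round_solved (n q : nat) (T : {set 'I_n}) (u : R) :
  \sum_(f : {ffun 'I_n * 'I_q -> bool})
      bernoulli_weight f * (if round_solved T f then u else 1)
    = 1 - (1 - (1 - p) ^+ (q * #|T|)) * (1 - u).
Proof.
pose h (x : 'I_n * 'I_q) (b : bool) : R := ((x.1 \in T) ==> ~~ b)%:R.
have -> : \sum_(f : {ffun 'I_n * 'I_q -> bool})
      bernoulli_weight f * (if round_solved T f then u else 1)
    = u * (\sum_(f : {ffun 'I_n * 'I_q -> bool}) bernoulli_weight f)
      + (1 - u) * (\sum_f bernoulli_weight f * \prod_x h x (f x)).
  rewrite !mulr_sumr -big_split; apply: eq_bigr => f _ /=.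
  rewrite (_ : \prod_x _ = (~~ round_solved T f)%:R).
    by case: round_solved => /=; ring.
  rewrite /h; have [|nsolved] := boolP (round_solved T f).
    case/exists_inP=> i iT /existsP[k fik].
    by rewrite (bigD1 (i, k)) //= iT fik mul0r.
  rewrite big1 // => -[i k] _ /=; case: (boolP (i \in T)) => //= iT.
  case: (boolP (f (i, k))) => // fik; case/negP: nsolved.
  by apply/exists_inP; exists i => //; apply/existsP; exists k.
rewrite expectation1 expectation_prod.
rewrite (_ : \prod_x _ = (1 - p) ^+ (q * #|T|)); first by ring.
have -> : (q * #|T|)%N = #|setX T [set: 'I_q]|.
  by rewrite cardsX cardsT card_ord mulnC.
rewrite -prodr_const [RHS]big_mkcond /=.
apply: eq_bigr => -[i k] _; rewrite /h inE /= inE andbT.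
by case: (i \in T) => /=; ring.
Qed.

(** The Laplace transform of the number of solved rounds is the [r]-th power of [1 - P * (1 - u)]
    with [u = expR (- l)], and [1 + l <= expR l] bounds this base by
    [expR (- (P * (l / (1 + l))))]. *)
Lemma chernoff_lower (r n q : nat) (T : {set 'I_n}) (l d P : R) : 0 <= l ->
  P = 1 - (1 - p) ^+ (q * #|T|) ->
  \sum_(omega : oracle r n q) bernoulli_weight omega
      * expR (l * ((1 - d) * P * r%:R
                   - (\sum_rho round_solved T (round_oracle omega rho))%:R))
    <= expR (r%:R * P * l * (1 - d - (1 + l)^-1)).
Proof.
move=> l0 defP.
have P0 : 0 <= P by rewrite defP subr_ge0 exprn_ile1 // gerBl.
pose u := expR (- l).
have -> : \sum_(omega : oracle r n q) bernoulli_weight omega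
      * expR (l * ((1 - d) * P * r%:R
                   - (\sum_rho round_solved T (round_oracle omega rho))%:R))
    = (\sum_(omega : oracle r n q) bernoulli_weight omega
        * \prod_rho (if round_solved T (round_oracle omega rho) then u else 1))
      * expR (l * (1 - d) * P * r%:R).
  rewrite mulr_suml; apply: eq_bigr => f _; rewrite -[RHS]mulrA; congr (_ * _).
  rewrite (eq_bigr (fun rho =>
    expR (- l * (round_solved T (round_oracle f rho))%:R))).
    rewrite -expR_sum -expRD; congr expR.
    by rewrite -mulr_sumr natr_sum; ring.
  by move=> rho _; case: round_solved; rewrite ?mulr1 // mulr0 expR0.
rewrite (expectation_rounds (fun _ f => if round_solved T f then u else 1)).
rewrite expectation_round_solved -defP prodr_const card_ord.
have u1 : l / (1 + l) <= 1 - u.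
  rewrite (_ : l / (1 + l) = 1 - (1 + l)^-1); last by field; lra.
  rewrite lerD2l lerN2 /u expRN lef_pV2 ?posrE ?expR_gt0 ?expR_ge1Dx //.
  lra.
have : 1 - P * (1 - u) <= expR (- (P * (l / (1 + l)))).
  by apply: le_trans (expR_ge1Dx _); rewrite lerD2l lerN2 ler_wpM2l.
have P1 : P <= 1 by rewrite defP gerBl exprn_ge0.
have : 0 <= 1 - P * (1 - u).
  have := expR_ge0 (- l); rewrite -/u; nra.
move=> ge0 le; have := lerXn2r r _ _ le.
rewrite !nnegrE ge0 expR_ge0 => /(_ isT isT) le'.
apply: le_trans (ler_wpM2r (expR_ge0 _) le') _.
rewrite -expRM_natl -expRD ler_expR le_eqVlt; apply/orP; left; apply/eqP.
by field; lra.
Qed.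

(** * Tail events over the oracle and the coins *)

Lemma probability_of_ge0 (r n q a z : nat) (u : sample r n q a z) :
  0 <= probability_of p u.
Proof.
by rewrite !mulr_ge0 ?exprn_ge0 ?invr_ge0 //; apply: bernoulli_weight_ge0.
Qed.

(** The coins are uniform and independent of the oracle, so a bound for all fixed coins survives
    averaging. They are fixed first because the adversary's coins determine which positions it
    queries. *)
Lemma expectation_sample_le (r n q a z : nat) (F : sample r n q a z -> R)
    (beta : R) :
  (forall (s : a.-tuple bool) (t : z.-tuple bool),
     \sum_omega bernoulli_weight omega * F (omega, s, t) <= beta) ->
  \sum_u probability_of p u * F u <= beta.
Proof.
move=> le.
have tuples m : \sum_(s : m.-tuple bool) 2^-1 ^+ m = 1 :> R.
  rewrite sumr_const card_tuple card_bool -[LHS]mulr_natr natrX -exprMn.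
  by rewrite mulVf ?expr1n // pnatr_eq0.
have -> : \sum_u probability_of p u * F u
    = \sum_(t : z.-tuple bool) \sum_(s : a.-tuple bool)
        2^-1 ^+ z * 2^-1 ^+ a *
          \sum_omega bernoulli_weight omega * F (omega, s, t).
  transitivity (\sum_v \sum_t probability_of p (v, t) * F (v, t)).
    by rewrite pair_bigA; apply: eq_bigr => -[].
  rewrite exchange_big; apply: eq_bigr => t _ /=.
  transitivity (\sum_o \sum_s probability_of p (o, s, t) * F (o, s, t)).
    by rewrite pair_bigA; apply: eq_bigr => -[].
  rewrite exchange_big; apply: eq_bigr => s _ /=.
  rewrite mulr_sumr; apply: eq_bigr => o _.
  by rewrite /probability_of /bernoulli_weight /=; ring.
apply: (@le_trans _ _ (\sum_(t : z.-tuple bool) \sum_(s : a.-tuple bool)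
    2^-1 ^+ z * 2^-1 ^+ a * beta)).
  apply: ler_sum => t _; apply: ler_sum => s _.
  by rewrite ler_wpM2l // mulr_ge0 ?exprn_ge0 ?invr_ge0.
under eq_bigr do rewrite -mulr_suml -mulr_sumr tuples mulr1.
by rewrite -mulr_suml tuples mul1r.
Qed.

Lemma probability_sum_le1 (r n q a z : nat) :
  \sum_(u : sample r n q a z) probability_of p u <= 1.
Proof.
under eq_bigr do rewrite -[probability_of _ _]mulr1.
apply: (expectation_sample_le (F := fun=> 1)) => s t.
by under eq_bigr do rewrite mulr1; rewrite expectation1.
Qed.

Lemma markov_expR (r n q a z : nat) (B : pred (sample r n q a z))
    (X : sample r n q a z -> R) (beta : R) :
  (forall u, B u -> 0 <= X u) ->
  (forall (s : a.-tuple bool) (t : z.-tuple bool),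
     \sum_omega bernoulli_weight omega * expR (X (omega, s, t)) <= beta) ->
  \sum_(u | B u) probability_of p u <= beta.
Proof.
move=> BX /(expectation_sample_le (F := fun u => expR (X u))).
apply: le_trans; rewrite big_mkcond; apply: ler_sum => u _.
have P0 := probability_of_ge0 u.
case: ifP => [/BX X0|_]; last by rewrite mulr_ge0 ?expR_ge0.
by rewrite ler_peMr // -expR0 ler_expR.
Qed.

(** Union bound: each term factors by independence, and the other execution has total mass at most
    1. *)
Lemma probability_pair_le (I J : finType) (P : I -> R) (Q : J -> R)
    (bad : pred (I * J)) (B : pred I) (C : pred J) (beta gamma : R) :
  (forall i, 0 <= P i) -> (forall j, 0 <= Q j) ->
  \sum_i P i <= 1 -> \sum_j Q j <= 1 ->
  \sum_(i | B i) P i <= beta -> \sum_(j | C j) Q j <= gamma ->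
  (forall u, bad u -> B u.1 || C u.2) ->
  \sum_(u | bad u) P u.1 * Q u.2 <= beta + gamma.
Proof.
move=> P0 Q0 P1 Q1 PB QC badP.
have split_le : \sum_(u | bad u) P u.1 * Q u.2
    <= \sum_u (if B u.1 then P u.1 else 0) * Q u.2
       + \sum_u P u.1 * (if C u.2 then Q u.2 else 0).
  rewrite -big_split big_mkcond; apply: ler_sum => -[i j] _ /=.
  have PQ : 0 <= P i * Q j by rewrite mulr_ge0.
  have := badP (i, j); case: (bad _) => [/(_ isT) /=|_].
    by case: (B i); case: (C j) => //;
      rewrite ?mul0r ?mulr0 ?addr0 ?add0r ?lerDl.
  by case: (B i); case: (C j); rewrite ?mul0r ?mulr0 ?addr0 // addr_ge0.
apply: le_trans split_le _.
rewrite -(pair_bigA _ (fun i j => (if B i then P i else 0) * Q j)) /=.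
rewrite -(pair_bigA _ (fun i j => P i * (if C j then Q j else 0))) /=.
rewrite -!big_distrlr /= -!big_mkcond /=; apply: lerD.
  apply: le_trans PB; rewrite ler_piMr //; exact: sumr_ge0.
apply: le_trans QC; rewrite ler_piMl //; exact: sumr_ge0.
Qed.

End Chernoff.

(** * Negligibility and the comparison of utilities *)

(** With [P = Q * 'X + b], the values of [Q] are eventually at least its leading coefficient, and
    half of this slope absorbs [b]. *)
Lemma horner_linear_growth (P : {poly rat}) :
  (1 < size P)%N -> 0 < lead_coef P ->
  exists2 C : rat, 0 < C & exists M, forall x, M <= x -> C * x <= P.[x].
Proof.
elim/poly_ind: P => [|Q b _]; first by rewrite size_poly0.
have [->|Q0] := eqVneq Q 0.
  by rewrite mul0r add0r size_polyC ltnNge leq_b1.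
have sQ : (size b%:P < size (Q * 'X)%R)%N.
  rewrite size_mulX // (leq_ltn_trans (size_polyC_leq1 _)) //.
  by rewrite ltnS size_poly_gt0.
rewrite lead_coefDl // lead_coefMX => _ lQ.
have [M QM] := poly_pinfty_gt_lc lQ.
exists (lead_coef Q / 2); first by rewrite divr_gt0.
exists (Num.max M (Num.max 0 (2 * `|b| / lead_coef Q))) => x.
rewrite !ge_max => /and3P[/QM Qx x0].
rewrite ler_pdivrMr // !hornerE => bx.
have := ler_norm (- b); rewrite normrN.
nra.
Qed.

(* A negative leading coefficient is excluded because the values are natural. *)
Lemma polynomial_values_growth (P : {poly rat}) (r : nat -> nat) :
  (1 < size P)%N -> polynomial_values P r ->
  exists2 C : nat, (0 < C)%N & exists K, forall kappa, (K < kappa)%N ->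
    (kappa <= C * r kappa)%N.
Proof.
move=> sP rP.
have large (M : rat) (kappa : nat) : (Num.trunc M < kappa)%N -> M <= kappa%:R.
  by move=> le; rewrite (le_trans (ltW (truncnS_gt M))) // ler_nat.
have [lP|lP] := ltP 0 (lead_coef P).
  have [C C0 [M MP]] := horner_linear_growth sP lP.
  exists (Num.trunc C^-1).+1 => //; exists (Num.trunc M) => kappa le.
  have := MP _ (large _ _ le); rewrite -rP ?(leq_ltn_trans _ le) // => CP.
  rewrite -(ler_nat rat) natrM; apply: (@le_trans _ _ (C^-1 * (r kappa)%:R)).
    by rewrite ler_pdivlMl.
  by rewrite ler_wpM2r // ltW // truncnS_gt.
have lNP : 0 < lead_coef (- P).
  rewrite lead_coefN oppr_gt0 lt_neqAle lP lead_coef_eq0 -size_poly_gt0.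
  by rewrite (ltnW sP).
have [||C C0 [M MP]] := @horner_linear_growth (- P); rewrite ?size_polyN //.
have := MP (Num.trunc M).+1%:R (large _ _ (leqnn _)).
rewrite hornerN -rP // => le.
have : (0 : rat) < C * (Num.trunc M).+1%:R by rewrite mulr_gt0.
by have := ler0n rat (r (Num.trunc M).+1); lra.
Qed.

(** As [r kappa] is at least [kappa / C], the inverse of the exponential is at least
    [(b * kappa) ^+ d.+1], one degree more than required. *)
Lemma negligible_expR (R : realType) (f : nat -> R) (r : nat -> nat) (g : R)
    (C K : nat) : 0 < g -> (0 < C)%N ->
  (forall kappa, (K < kappa)%N -> (kappa <= C * r kappa)%N) ->
  (forall kappa, (0 < kappa)%N ->
     0 <= f kappa <= 2 * expR (- (g * (r kappa)%:R))) ->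
  negligible f.
Proof.
move=> g0 C0 rK fP d.
(* Chosen so that [d.+1 * b * kappa] equals [g * kappa / C]. *)
pose b : R := g / (C%:R * d.+1%:R).
have b0 : 0 < b by rewrite divr_gt0 // mulr_gt0 // ltr0n.
(* Beyond this threshold the spare factor [kappa] absorbs [2 / b ^+ d.+1]. *)
exists (maxn K (Num.trunc (2 / b ^+ d.+1))) => kappa.
rewrite gtn_max => /andP[/rK rk large].
have k0 : (0 < kappa)%N by exact: leq_ltn_trans large.
have kR : (0 : R) < kappa%:R by rewrite ltr0n.
have /andP[f0 fle] := fP _ k0; rewrite ger0_norm //; apply: le_lt_trans fle _.
have bk0 : 0 < b * kappa%:R by rewrite mulr_gt0.
have lower : (b * kappa%:R) ^+ d.+1 <= expR (g * (r kappa)%:R).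
  apply: (@le_trans _ _ (expR (b * kappa%:R) ^+ d.+1)).
    apply: lerXn2r; rewrite ?nnegrE ?expR_ge0 ?(ltW bk0) //.
    by apply: le_trans (expR_ge1Dx _); lra.
  rewrite -expRM_natl ler_expR /b.
  have -> : d.+1%:R * (g / (C%:R * d.+1%:R) * kappa%:R) = g * (kappa%:R / C%:R).
    have D0 : d.+1%:R != 0 :> R by rewrite pnatr_eq0.
    have CR : C%:R != 0 :> R by rewrite pnatr_eq0 -lt0n.
    by move: d.+1%:R D0 => D D0; field; rewrite CR.
  rewrite ler_wpM2l ?(ltW g0) // ler_pdivrMr ?ltr0n //.
  by rewrite mulrC -natrM ler_nat.
rewrite expRN; apply: (@le_lt_trans _ _ (2 * ((b * kappa%:R) ^+ d.+1)^-1)).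
  rewrite ler_wpM2l // lef_pV2 ?posrE ?expR_gt0 // exprn_gt0 //.
rewrite ltr_pdivrMr ?exprn_gt0 // exprMn (exprSr kappa%:R).
have kd : (kappa%:R : R) ^+ d != 0 by rewrite expf_neq0 // gt_eqF.
have -> : (kappa%:R ^+ d)^-1 * (b ^+ d.+1 * (kappa%:R ^+ d * kappa%:R))
   = b ^+ d.+1 * kappa%:R :> R by field.
rewrite -ltr_pdivrMl ?exprn_gt0 // mulrC.
by apply: lt_le_trans (truncnS_gt _) _; rewrite ler_nat.
Qed.

(** Equivalent to [(1 - p) ^+ m * (1 + p * m) <= 1], proved by induction on [m]. *)
Lemma bernoulli_lower (R : realFieldType) (p : R) (m : nat) : 0 <= p <= 1 ->
  p * m%:R / (1 + p * m%:R) <= 1 - (1 - p) ^+ m.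
Proof.
case/andP=> p0 p1.
have q0 k : 0 <= (1 - p) ^+ k by rewrite exprn_ge0 // subr_ge0.
have le : (1 - p) ^+ m * (1 + p * m%:R) <= 1.
  elim: m => [|m IH]; first by rewrite mulr0 addr0 mulr1.
  apply: le_trans IH; rewrite exprSr -mulrA ler_wpM2l //.
  have m0 : (0 : R) <= m%:R by [].
  by rewrite -natr1; nra.
have a0 : 0 <= p * m%:R by rewrite mulr_ge0.
rewrite ler_pdivrMr; nra.
Qed.

(** [X] and [m] stand for the adversary's successes and queries, [Y] for the rounds solved by a
    compliant [T], [t] for the size of [T]. Both utilities are compared through the lower bound [V]
    of the compliant one. *)
Lemma equilibrium_inequality (R : realFieldType)
    (p w c s phi d t q n r X m Y P : R) :
  let a := p * q * t in
  0 <= p -> 0 <= q -> 0 <= r -> 0 < w -> 0 <= c -> 0 <= t <= n - 1 ->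
  s = p * q * n -> 0 < phi -> phi < 1 - s -> 0 < d -> d < 4^-1 ->
  c <= p * w * (1 - d) * phi / (1 + p * q * (n - 1)) ->
  0 <= m <= r * (q * t) -> X <= p * m + d * (a * r) ->
  a / (1 + a) <= P -> (1 - d) * P * r <= Y ->
  w * X - c * m <= (w * Y - c * (r * (q * t)))
    + (4 * d * (1 + s) + s) / (1 - phi) * `|w * Y - c * (r * (q * t))|.
Proof.
move=> a p0 q0 r0 w0 c0 /andP[t0 tn] defs phi0 phis d0 d4 hc.
move=> /andP[m0 mle] hX hP hY.
have pq0 : 0 <= p * q by rewrite mulr_ge0.
have a0 : 0 <= a by rewrite /a mulr_ge0.
have as_ : a <= s by rewrite /a defs ler_wpM2l //; lra.
have ale : a <= p * q * (n - 1) by rewrite ler_wpM2l.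
have s0 : 0 <= s by lra.
have a1 : 0 < 1 + a by lra.
have hc1 : c * (1 + a) <= p * w * (1 - d) * phi.
  move: hc; rewrite ler_pdivlMr; last by lra.
  by apply: le_trans; rewrite ler_wpM2l // lerD2l.
have cpw : c <= p * w.
  apply: (@le_trans _ _ (c * (1 + a))).
    by rewrite ler_peMr // lerDl.
  apply: le_trans hc1 _.
  rewrite -mulrA -[leRHS]mulr1 ler_wpM2l ?mulr_ge0 ?(ltW w0) //.
  have : d * phi >= 0 by rewrite mulr_ge0 // ltW.
  lra.
set U := w * Y - _; set B := a / (1 + a) in hP *.
have B0 : 0 <= B by rewrite divr_ge0 // ltW.
have defa : a = B * (1 + a) by rewrite /B divfK // gt_eqF.
have cqt : c * (q * t) <= w * (1 - d) * phi * B.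
  rewrite -(ler_pM2r a1) -[leRHS]mulrA -defa.
  have := ler_wpM2r (mulr_ge0 q0 t0) hc1.
  by rewrite /a; lra.
(* The utility guaranteed to a compliant [T], with [Y] and then [P] replaced by their lower
   bounds. *)
pose V := r * (w * (1 - d) * B - c * (q * t)).
have VU : V <= U.
  have d1r : 0 <= (1 - d) * r by rewrite mulr_ge0 //; lra.
  have := ler_wpM2l (ltW w0) (ler_wpM2r d1r hP).
  have := ler_wpM2l (ltW w0) hY.
  by rewrite /V /U; lra.
have V_ge : r * w * (1 - d) * (1 - phi) * B <= V.
  by have := ler_wpM2l r0 cqt; rewrite /V; lra.
pose E := 4 * d * (1 + s) + s; rewrite -/E.
have E0 : 0 <= E by rewrite addr_ge0 // !mulr_ge0 //; lra.
have V_ge0 : 0 <= V.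
  apply: (le_trans _ V_ge).
  by rewrite !mulr_ge0 ?invr_ge0 ?(ltW w0) ?(ltW a1) //; lra.
have e0 : 0 <= E / (1 - phi) by rewrite divr_ge0 //; lra.
rewrite ger0_norm; last exact: le_trans VU.
apply: (@le_trans _ _ (V + E / (1 - phi) * V)); last first.
  by rewrite lerD // ler_wpM2l.
apply: (@le_trans _ _ (r * (w * a * (1 + d) - c * (q * t)))).
  (* As [c <= p * w], more queries never lower the adversary's bound, so [m] is replaced by its
     maximum. *)
  have cpw0 : 0 <= p * w - c by rewrite subr_ge0.
  have := ler_wpM2l (ltW w0) hX; have := ler_wpM2l cpw0 mle.
  by rewrite /a; lra.
apply: (@le_trans _ _ (V + E / (1 - phi)
    * (r * w * (1 - d) * (1 - phi) * B))); last first.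
  by rewrite lerD2l ler_wpM2l.
have -> : E / (1 - phi) * (r * w * (1 - d) * (1 - phi) * B)
    = r * w * B * (E * (1 - d)) by field; lra.
(* The right side minus the left is exactly the sum of the quantities in [h1] and [h2]; [d < 4^-1]
   makes [1 - 2 * d] positive. *)
have key : (1 + a) * (1 + d) - (1 - d) <= E * (1 - d).
  have h1 : 0 <= (s - a) * (1 + d) by rewrite mulr_ge0 //; lra.
  have h2 : 0 <= 2 * d * (1 + s) * (1 - 2 * d) by rewrite !mulr_ge0 //; lra.
  by rewrite /E; lra.
have rwB : 0 <= r * w * B by exact: mulr_ge0 (mulr_ge0 r0 (ltW w0)) B0.
have := ler_wpM2l rwB key.
by rewrite /V [in w * a]defa; lra.
Qed.

(** * Utilities in terms of oracle successes *)

Definition adversarial_positions (r n q : nat) (T : {set 'I_n})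
    (x : {ffun 'I_n -> 'I_q.+1}) : {set 'I_r * 'I_n * 'I_q} :=
  [set y : 'I_r * 'I_n * 'I_q | (y.1.2 \in T) && (y.2 < q - x y.1.2)%N].

Lemma sum_adversarial_positions (r n q : nat) (T : {set 'I_n})
    (x : {ffun 'I_n -> 'I_q.+1}) (F : 'I_r * 'I_n * 'I_q -> nat) :
  (\sum_(y in adversarial_positions r T x) F y
    = \sum_(rho < r) \sum_(i in T) \sum_(k < q | k < q - x i) F (rho, i, k))%N.
Proof.
under [RHS]eq_bigr do rewrite pair_big_dep.
rewrite pair_big_dep /=.
rewrite (reindex (fun y : 'I_r * ('I_n * 'I_q) =>
  (y.1, y.2.1, y.2.2))) /=; last first.
  by exists (fun x => (x.1.1, (x.1.2, x.2))) => [[? []]|[[? ?] ?]].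
by apply: eq_bigl => -[rho [i k]]; rewrite inE.
Qed.

Lemma adversarial_solutionsE (r n q : nat) (T : {set 'I_n})
    (x : {ffun 'I_n -> 'I_q.+1}) (omega : oracle r n q) :
  adversarial_solutions T x omega
    = (\sum_(y in adversarial_positions r T x) omega y)%N.
Proof. by rewrite (sum_adversarial_positions _ _ (fun y => omega y)). Qed.

Lemma card_adversarial_positions (r n q : nat) (T : {set 'I_n})
    (x : {ffun 'I_n -> 'I_q.+1}) :
  #|adversarial_positions r T x| = (\sum_(i in T) r * (q - x i))%N.
Proof.
rewrite -sum1_card sum_adversarial_positions sum_nat_const card_ord -big_distrr.
congr muln; apply: eq_bigr => i _.
rewrite -[RHS](@size_filter_ltn_ord _ q) ?leq_subr //.
by rewrite -sum1_size big_filter big_enum_cond.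
Qed.

Lemma leq_card_adversarial_positions (r n q : nat) (T : {set 'I_n})
    (x : {ffun 'I_n -> 'I_q.+1}) :
  (#|adversarial_positions r T x| <= r * (q * #|T|))%N.
Proof.
rewrite card_adversarial_positions mulnA [leqRHS]mulnC -sum_nat_const.
by apply: leq_sum => i _; rewrite leq_mul2l leq_subr orbT.
Qed.

Lemma rewardE (R : realType) (n : nat) (w : R) (T : {set 'I_n}) (j : 'I_n)
    (e : execution n) : reward w T j e = w * (produced T (local_chain e j))%:R.
Proof. by rewrite /reward big_const_seq iter_addr_0 mulr_natr. Qed.

Lemma sum_costE (R : realType) (n : nat) (c : R) (T : {set 'I_n})
    (e : execution n) :
  \sum_(i in T) cost c i e = c * (\sum_(i in T) queries e i)%:R.
Proof. by rewrite natr_sum mulr_sumr. Qed.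

(** [#|T| < n] provides a participant outside [T], so the default value 0 does not occur. *)
Lemma utility_max_le (R : realType) (n : nat) (U : utility R n)
    (T : {set 'I_n}) (e : execution n) (B : R) : (#|T| < n)%N ->
  (forall j, j \notin T -> U T j e <= B) -> utility_max U T e <= B.
Proof.
move=> cardT UB; rewrite /utility_max; case: pickP => [j0 j0T|all_in].
  by apply: (big_ind (fun y => y <= B)) => [|y z yB zB|];
    rewrite ?UB // ge_max yB.
case/negP: (negbT (ltn_geF cardT)); rewrite -[leqLHS]card_ord.
by apply/subset_leq_card/subsetP => j _; move/negbFE: (all_in j).
Qed.

Lemma utility_min_const (R : realType) (n : nat) (U : utility R n)
    (T : {set 'I_n}) (e : execution n) (B : R) : (#|T| < n)%N ->
  (forall j, j \notin T -> U T j e = B) -> utility_min U T e = B.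
Proof.
move=> cardT UB; rewrite /utility_min; case: pickP => [j0 j0T|all_in].
  by apply: (big_ind (fun y => y = B)) => [|y z -> ->|]; rewrite ?UB // minxx.
case/negP: (negbT (ltn_geF cardT)); rewrite -[leqLHS]card_ord.
by apply/subset_leq_card/subsetP => j _; move/negbFE: (all_in j).
Qed.

Lemma adversary_utility_max_le (R : realType) (r n q kappa : nat)
    (A : adversary n q) (Z : environment) (omega : oracle r n q)
    (acoins zcoins : bits) (w c : R) :
  let T := corrupted A in let x := withheld A kappa acoins in
  0 <= w -> (#|T| < n)%N ->
  utility_max (reward_minus_cost w c) T
      (execute A Z omega kappa acoins zcoins)
    <= w * (adversarial_solutions T x omega)%:R
       - c * #|adversarial_positions r T x|%:R.
Proof.
move=> T x w0 cardT; apply: utility_max_le => // j _.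
rewrite /reward_minus_cost rewardE sum_costE card_adversarial_positions.
rewrite (eq_bigr (fun i => (r * (q - x i))%N)) => [|i iT]; last first.
  exact: execute_queries.
by rewrite lerD2r ler_wpM2l // ler_nat execute_produced.
Qed.

Lemma compliant_utility_min (R : realType) (r n q kappa : nat)
    (T : {set 'I_n}) (Z : environment) (omega : oracle r n q)
    (acoins zcoins : bits) (w c : R) : (#|T| < n)%N ->
  utility_min (reward_minus_cost w c) T
      (execute (compliant q T) Z omega kappa acoins zcoins)
    = w * (\sum_(rho < r) round_solved T (round_oracle omega rho))%:R
      - c * (r%:R * (q%:R * #|T|%:R)).
Proof.
move=> cardT; apply: utility_min_const => // j jT.
rewrite /reward_minus_cost rewardE sum_costE execute_compliant //.
rewrite (eq_bigr (fun=> (r * q)%N)) => [|i iT].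
  by rewrite sum_nat_const !natrM; congr (_ - _ * _); ring.
by rewrite execute_queries // /withheld /= ffunE subn0.
Qed.

(** * Tail estimates and the equilibrium *)

Theorem theorem3 (R : realType) (n q : nat) (p c w s phi : R)
  (hn : (0 < n)%N) (hp : 0 <= p <= 1) (hc : 0 <= c) (hw : 0 < w)
  (hs : s = p * q%:R * n%:R)
  (hphi : 0 < phi < 1 - s)
  (hcphi : c < p * w * phi / (1 + p * q%:R * (n%:R - 1)))
  (delta1 : R) (hdelta1 : 0 < delta1 < 4^-1)
  (hcdelta1 : c <= p * w * (1 - delta1) * phi / (1 + p * q%:R * (n%:R - 1)))
  (heps : 4 * delta1 * (1 + s) + s < 1 - phi) :
  bitcoin_EVP (n := n) q p n.-1 ((4 * delta1 * (1 + s) + s) / (1 - phi)) 0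
    (reward_minus_cost w c).
Proof.
move=> A r Z T H _ cardT [_ _ [pol sz_pol pol_r] _].
have [C C0 [K growth]] := polynomial_values_growth sz_pol pol_r.
have {}cardT : (#|T| < n)%N by rewrite (leq_ltn_trans cardT) ?ltn_predL.
have /andP[phi0 phis] := hphi; have /andP[d0 d4] := hdelta1.
have /andP[p0 p1] := hp.
pose x kappa (u : samples r A Z kappa) := withheld A kappa u.1.2.
pose S kappa (u : samples r A Z kappa) :=
  adversarial_positions (r kappa) T (x kappa u).
pose a := p * q%:R * #|T|%:R.
pose P := 1 - (1 - p) ^+ (q * #|T|).
have a0 : 0 <= a by rewrite !mulr_ge0.
have aP : a / (1 + a) <= P.
  have -> : a = p * (q * #|T|)%:R by rewrite natrM mulrA.
  exact: bernoulli_lower.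
(* The margin is relative to [a * r kappa], the mean when all queries are asked; the actual mean may
   be smaller. *)
pose excess kappa (u : samples r A Z kappa) : R :=
  \sum_(y in S kappa u) (u.1.1 y)%:R - p * #|S kappa u|%:R
    - delta1 * (a * (r kappa)%:R).
pose deficit kappa (u : samples r H Z kappa) : R :=
  (1 - delta1) * P * (r kappa)%:R
    - (\sum_rho round_solved T (round_oracle u.1.1 rho))%:R.
set f := (X in negligible X).
(* Unless [excess] or [deficit] is positive, [equilibrium_inequality] applies; [f] is therefore
   bounded by the two tails. *)
have fP kappa (beta gamma : R) :
    \sum_(u | 0 < excess kappa u) probability_of p u <= beta ->
    \sum_(u | 0 < deficit kappa u) probability_of p u <= gamma ->
    0 <= f kappa <= beta + gamma.
  move=> B1 B2; apply/andP; split.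
    by apply: sumr_ge0 => u _; rewrite mulr_ge0 // probability_of_ge0.
  apply: probability_pair_le B1 B2 _; rewrite ?probability_sum_le1 //.
  - by move=> u; rewrite probability_of_ge0.
  - by move=> u; rewrite probability_of_ge0.
  move=> [u v] /=; apply: contraR; rewrite negb_or -!leNgt => /andP[eu dv].
  rewrite addr0 compliant_utility_min //.
  apply: le_trans (adversary_utility_max_le _ _ _ _ _ _ (ltW hw) cardT) _.
  rewrite adversarial_solutionsE natr_sum.
  apply: (@equilibrium_inequality R p w c s phi delta1 #|T|%:R q%:R n%:R
    (r kappa)%:R _ _ _ P) => //.
  - by rewrite ler0n /= lerBrDr natr1 ler_nat.
  - by rewrite ler0n /= -!natrM ler_nat leq_card_adversarial_positions.
  - by move: eu; rewrite /excess /S /x /a; lra.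
  - by move: dv; rewrite /deficit; lra.
(* If [a = 0] there is no positive rate. But [p = 0] would give [c < 0], so [q * #|T| = 0] and
   neither bad event can occur. *)
have [a_eq0|a_neq0] := eqVneq a 0.
  apply: (@negligible_expR _ _ r 1 C K) => // kappa _.
  have qT0 : (q * #|T| = 0)%N.
    apply/eqP; move: a_eq0 => /eqP; rewrite /a -mulrA -natrM mulf_eq0 pnatr_eq0.
    by case/orP => // /eqP pE; move: hcphi; rewrite pE !mul0r ltNge hc.
  have /andP[f0 f_le0] : 0 <= f kappa <= 0 + 0.
    apply: fP; rewrite big_pred0 // => u; apply/negbTE; rewrite -leNgt.
      have /cards0_eq S0 : #|S kappa u| = 0%N.
        apply/eqP; rewrite -leqn0.
        rewrite (leq_trans (leq_card_adversarial_positions _ _ _)) //.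
        by rewrite qT0 muln0.
      by rewrite /excess S0 big_set0 cards0 a_eq0; lra.
    by rewrite /deficit /P qT0 expr0 subrr mulr0 mul0r sub0r oppr_le0.
  by rewrite f0 (le_trans f_le0) ?addr0 ?mulr_ge0 ?expR_ge0.
have a_gt0 : 0 < a by rewrite lt_def a_neq0.
have P_gt0 : 0 < P by apply: lt_le_trans aP; rewrite divr_gt0 // addr_gt0.
(* With this [l], [l / (1 - l) < delta1] because [delta1 < 1], so [g1] is positive. The lower tail
   uses the parameter [delta1], and [g2] is positive because [(1 - delta1) * (1 + delta1) < 1]. *)
pose l := delta1 / 2.
pose g1 := l * a * (delta1 - l / (1 - l)).
pose g2 := P * delta1 * ((1 + delta1)^-1 - (1 - delta1)).
have g1_gt0 : 0 < g1.
  apply: mulr_gt0; first by rewrite mulr_gt0 // divr_gt0.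
  rewrite subr_gt0 ltr_pdivrMr /l; last lra.
  nra.
have g2_gt0 : 0 < g2.
  apply: mulr_gt0; first by rewrite mulr_gt0.
  rewrite subr_gt0 -div1r ltr_pdivlMr; last lra.
  nra.
apply: (@negligible_expR _ _ r (Num.min g1 g2) C K) => // [|kappa _].
  by rewrite lt_min g1_gt0.
have mono (g : R) : Num.min g1 g2 <= g ->
    expR (- (g * (r kappa)%:R)) <= expR (- (Num.min g1 g2 * (r kappa)%:R)).
  by move=> le; rewrite ler_expR lerN2 ler_wpM2r.
(* The factor 2 splits into one exponential for each bad event. *)
rewrite mulr_natl mulr2n; apply: fP.
  apply: (le_trans _ (mono g1 _)); last by rewrite ge_min lexx.
  apply: (markov_expR hp (X := fun u => l * excess kappa u)) => [u e0|st zt].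
    by rewrite mulr_ge0 ?(ltW e0) // divr_ge0 // ltW.
  have -> : - (g1 * (r kappa)%:R)
    = l * (a * (r kappa)%:R) * (l / (1 - l) - delta1) by rewrite /g1; ring.
  apply: (chernoff_upper hp
    (S := adversarial_positions _ T (withheld A kappa st))).
    by rewrite /l; apply/andP; split; lra.
  rewrite /a -!mulrA ler_wpM2l // -!natrM ler_nat.
  by rewrite [(#|T| * _)%N]mulnC mulnCA leq_card_adversarial_positions.
apply: (le_trans _ (mono g2 _)); last by rewrite ge_min lexx orbT.
apply: (markov_expR hp (X := fun u => delta1 * deficit kappa u))
  => [u e0|st zt].
  by rewrite mulr_ge0 ?(ltW e0) // ltW.
have -> : - (g2 * (r kappa)%:R)
  = (r kappa)%:R * P * delta1 * (1 - delta1 - (1 + delta1)^-1).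
  by rewrite /g2; ring.
exact: (chernoff_lower hp _ _ (ltW d0) (erefl P)).
Qed.
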